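(* Let $G$ be a simple graph with $m\ge 1$ edges and minimum degree $\delta(G)$, and let $\alpha \in [0,1)$. Then the smallest eigenvalue of $A_\alpha(l(G))$ satisfies $$\lambda_m(A_\alpha(l(G))) \geq 2\alpha\,\delta(G) - 2.$$
   Context: For a simple graph $H$ with adjacency matrix $A(H)$ and diagonal degree matrix $D(H)$, and $\alpha\in[0,1]$, $A_\alpha(H)=\alpha D(H)+(1-\alpha)A(H)$, with eigenvalues ordered $\lambda_1\ge\dots\ge\lambda_k$. The line graph $l(G)$ has the edges of $G$ as vertices, two being adjacent iff the corresponding edges of $G$ share an endpoint; it has $m$ vertices. *)

(* Defs.v *)
From HB Require Import structures.
From mathcomp Require Import all_boot all_order all_algebra.
From mathcomp Require Import polyrcf reals.

Set Implicit Arguments.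
Unset Strict Implicit.
Unset Printing Implicit Defensive.

Import Order.TTheory GRing.Theory Num.Theory.
Local Open Scope ring_scope.

Record sgraph := SGraph {
  vertex :> finType;
  adj : rel vertex;
  adj_sym : symmetric adj;
  adj_irr : irreflexive adj
}.

Definition deg (G : sgraph) (x : G) : nat := #|[set y : G | adj x y]|.

(* Every degree is at most the number of vertices, so the initial value #|G|
   does not affect the minimum as soon as G has a vertex. *)
Definition min_deg (G : sgraph) : nat := \big[minn/#|G|]_(x : G) deg x.

Definition edges (G : sgraph) : {set {set G}} :=
  [set E : {set G} | [exists x, exists y, adj x y && (E == [set x; y])]].

Definition edge_type (G : sgraph) : finType := {E : {set G} | E \in edges G}.

Definition line_adj (G : sgraph) : rel (edge_type G) :=
  fun E F => (E != F) && (val E :&: val F != set0).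

Lemma line_adj_sym (G : sgraph) : symmetric (@line_adj G).
Proof. by move=> E F; rewrite /line_adj eq_sym setIC. Qed.

Lemma line_adj_irr (G : sgraph) : irreflexive (@line_adj G).
Proof. by move=> E; rewrite /line_adj eqxx. Qed.

Definition line_graph (G : sgraph) : sgraph :=
  SGraph (@line_adj_sym G) (@line_adj_irr G).

(* Matrices of a graph are indexed by the ordinals of 'I_#|G|, through the
   enumeration enum_val of the vertices. *)
Definition adj_mx (R : rcfType) (G : sgraph) : 'M[R]_#|G| :=
  \matrix_(i, j) (adj (enum_val i) (enum_val j))%:R.

Definition deg_mx (R : rcfType) (G : sgraph) : 'M[R]_#|G| :=
  diag_mx (\row_i (deg (enum_val i))%:R).

Definition A_alpha (R : rcfType) (alpha : R) (G : sgraph) : 'M[R]_#|G| :=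
  alpha *: deg_mx R G + (1 - alpha) *: adj_mx R G.

(* Eigenvalues in R, repeated according to their multiplicity as roots of the
   characteristic polynomial, in nonincreasing order (rootsR lists the distinct
   roots in increasing order). *)
Definition eigenvalues (R : rcfType) (n : nat) (A : 'M[R]_n) : seq R :=
  let p := char_poly A in
  rev (flatten [seq nseq (mup x p) x | x <- rootsR p]).

(* lambda k A is the k-th largest eigenvalue, 1 <= k <= n. A symmetric A has n
   eigenvalues in R, so the default value of nth is then never reached. *)
Definition lambda (R : rcfType) (k n : nat) (A : 'M[R]_n) : R :=
  nth 0 (eigenvalues A) k.-1.

(* Main.v *)
(** Counting incidences between vertices and edges gives
    [2 I + A(l(G)) = B^T B], where [B] is the vertex-edge incidence matrix, and
    [2 + deg e = deg u + deg v >= 2 delta] for every edge [e = uv]. Hence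
    [A(l(G)) >= -2] and [D(l(G)) >= 2 delta - 2] as quadratic forms, and
    [A_alpha(l(G)) >= alpha (2 delta - 2) - 2 (1 - alpha) = 2 alpha delta - 2].
    Since [lambda] defaults to [0] beyond the list of real eigenvalues, one also
    needs that the characteristic polynomial of a real symmetric matrix splits:
    its complex roots are eigenvalues of a hermitian matrix, hence real. *)
Require Import Defs.
From mathcomp Require Import all_boot all_order all_algebra.
From mathcomp Require Import reals.
From mathcomp Require Import polyrcf complex ring lra.

Import Order.TTheory GRing.Theory Num.Theory.
Local Open Scope ring_scope.

Set Implicit Arguments.
Unset Strict Implicit.
Unset Printing Implicit Defensive.

(** Only the block of [x] contributes, and it occurs once as [s] is duplicate-free; if [x] is not in
    [s], it is no root and both sides are 0. *)
Lemma count_mem_nseq_mup (F : fieldType) (p : {poly F}) (s : seq F) (x : F) :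
  uniq s -> (forall y, root p y -> y \in s) ->
  count_mem x (flatten [seq nseq (mup y p) y | y <- s]) = mup x p.
Proof.
move=> us sP; rewrite count_flatten -map_comp sumnE big_map.
have E y : (y != x) -> (count_mem x \o (fun y => nseq (mup y p) y)) y = 0%N.
  by move=> /negPf yx /=; rewrite count_nseq /= yx.
have [xs|xs] := boolP (x \in s).
  rewrite (bigD1_seq x) //= big1 ?addn0; last by move=> y /E.
  by rewrite count_nseq /= eqxx mul1n.
rewrite big_seq big1 => [|y ys]; last first.
  by apply: E; apply: contraNneq xs => <-.
by rewrite mupNroot //; apply: contra xs => /sP.
Qed.

Lemma perm_eigenvalues (R : rcfType) n (A : 'M[R]_n) (s : seq R) :
  char_poly A = \prod_(z <- s) ('X - z%:P) -> perm_eq (eigenvalues A) s.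
Proof.
move=> As; rewrite /eigenvalues perm_rev; apply/allP => x _ /=.
rewrite count_mem_nseq_mup ?uniq_roots //.
  by rewrite As mu_prod_XsubC.
move=> y py; have p0 := monic_neq0 (char_poly_monic A).
by rewrite -(roots_on_rootsR p0) in_itv.
Qed.

(** For a left eigenvector [v] and [w] its conjugate transpose, computing [v B w] in two ways gives
    [a (v w) = conjc a (v w)], where [v w] is the nonzero sum of the squared moduli of the entries
    of [v]. *)
Lemma symmetric_eigenvalue_real (R : rcfType) n (A : 'M[R]_n) (a : R[i]) :
  A^T = A -> eigenvalue (map_mx (real_complex R) A) a -> a = (complex.Re a)%:C%C.
Proof.
move=> Asym /eigenvalueP [v vA v0].
pose B := map_mx (real_complex R) A.
pose w := (map_mx (@conjc R) v)^T.
have BwE : B *m w = conjc a *: w.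
  have Bc : map_mx (@conjc R) B = B.
    by apply/matrixP => i j; rewrite !mxE conjc_real.
  apply: trmx_inj; rewrite trmx_mul linearZ /= trmxK /B map_trmx Asym -/B.
  by rewrite -{1}Bc -map_mxM vA map_mxZ.
have : a *: (v *m w) = conjc a *: (v *m w).
  by rewrite scalemxAl -vA -mulmxA BwE -scalemxAr.
move/matrixP/(_ 0 0); rewrite !mxE.
have N0 : \sum_j v 0 j * w j 0 != 0.
  apply: contraNneq v0 => N0; apply/eqP/rowP => j; rewrite mxE.
  have : \sum_j `|v 0 j| ^+ 2 == 0.
    by rewrite -[X in _ == X]N0; apply/eqP/eq_bigr => k _; rewrite !mxE sqr_normc.
  rewrite psumr_eq0 => [/allP/(_ j (mem_index_enum _))|k _]; last exact: exprn_ge0.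
  by rewrite sqrf_eq0 normr_eq0 => /eqP.
move/(mulIf N0); case: a {vA BwE} => x y [yE]; congr Complex; lra.
Qed.

(** Over [R[i]] the polynomial splits; each root equals its real part, so the factorization descends
    along the injective embedding of [R]. *)
Lemma symmetric_char_poly_split (R : rcfType) n (A : 'M[R]_n) :
  A^T = A -> exists s : seq R, char_poly A = \prod_(z <- s) ('X - z%:P).
Proof.
move=> Asym; pose B := map_mx (real_complex R) A.
have [r] := closed_field_poly_normal (char_poly B).
rewrite (monicP (char_poly_monic B)) scale1r => Br.
exists [seq complex.Re z | z <- r].
apply: (@map_inj_poly _ _ (real_complex R)) => //; first exact: complexI.
rewrite map_char_poly Br big_map rmorph_prod /= [LHS]big_seq [RHS]big_seq.
apply: eq_bigr => z zr; rewrite rmorphB /= map_polyX map_polyC /=.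
rewrite -(symmetric_eigenvalue_real Asym) // eigenvalue_root_char -/B Br.
by rewrite root_prod_XsubC.
Qed.

Lemma lambda_symmetric_eigenvalue (R : rcfType) n (A : 'M[R]_n) k :
  A^T = A -> (0 < k <= n)%N -> eigenvalue A (lambda k A).
Proof.
move=> /symmetric_char_poly_split [s As] /andP[k0 kn].
have pAs := perm_eigenvalues As.
rewrite eigenvalue_root_char As root_prod_XsubC -(perm_mem pAs).
(* The list has length [n], one less than the size of the characteristic polynomial, so index [k.-1]
   is in range and the default 0 is not reached. *)
rewrite mem_nth // (perm_size pAs) -ltnS -(size_prod_XsubC _ id) -As.
by rewrite size_char_poly ltnS prednK.
Qed.

(** Rayleigh quotient: at an eigenvector the form equals [a] times the positive sum of squares. *)
Lemma eigenvalue_ge (R : realFieldType) n (A : 'M[R]_n) (c a : R) :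
  (forall x : 'rV_n, c * \sum_i x 0 i ^+ 2 <= \sum_i \sum_j x 0 i * A i j * x 0 j) ->
  eigenvalue A a -> c <= a.
Proof.
move=> qA /eigenvalueP [v vA v0].
have N0 : 0 < \sum_i v 0 i ^+ 2.
  rewrite lt0r sumr_ge0 => [|i _]; last exact: sqr_ge0.
  rewrite andbT; apply: contraNneq v0 => /eqP.
  rewrite psumr_eq0 => [/allP h|i _]; last exact: sqr_ge0.
  apply/eqP/rowP => j; rewrite mxE; apply/eqP.
  by rewrite -sqrf_eq0; apply: h; rewrite mem_index_enum.
rewrite -(ler_pM2r N0); apply: le_trans (qA v) _.
rewrite exchange_big mulr_sumr /= le_eqVlt; apply/orP; left; apply/eqP/eq_bigr => j _.
move/rowP/(_ j): vA; rewrite !mxE => vAj.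
by rewrite -mulr_suml vAj expr2 mulrA.
Qed.

Section LineGraph.
Variable G : sgraph.
Implicit Types e f : line_graph G.

Lemma card_edge e : #|val e| = 2%N.
Proof.
have := valP e; rewrite inE => /existsP[x /existsP[y /andP[xy /eqP->]]].
by rewrite cards2; case: eqP xy => // ->; rewrite adj_irr.
Qed.

(** This is the entrywise form of [B^T B = 2 I + A(l(G))]: distinct edges share at most one
    vertex. *)
Lemma card_edgeI e f : #|val e :&: val f| = ((e == f) * 2 + adj e f)%N.
Proof.
rewrite /= /line_adj; have [->|ef] := eqVneq e f; first by rewrite setIid card_edge.
rewrite -cards_eq0 /= -lt0n; have : (#|val e :&: val f| < 2)%N; last first.
  by case: #|_| => [|[|]].
rewrite -(card_edge e); apply/proper_card.
(* If the intersection were all of [e], then [e] would lie in [f], and equal sizes would force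
   [e = f]. *)
rewrite properEneq subsetIl andbT; apply: contraNneq ef => eI.
apply/eqP/val_inj/eqP; rewrite eqEcard !card_edge leqnn andbT.
by rewrite -eI subsetIr.
Qed.

(** The map sending [y] to [[set x; y]] is injective from the neighbours of [x] into the edges
    containing [x]. *)
Lemma deg_le_incident (x : G) : (deg x <= \sum_(f : line_graph G) (x \in val f))%N.
Proof.
have -> : (\sum_(f : line_graph G) (x \in val f) = #|[set val f | f in [set f : line_graph G | x \in val f]]|)%N.
  rewrite card_imset; last exact: val_inj.
  rewrite -sum1_card [RHS]big_mkcond /=; apply: eq_bigr => f _; rewrite inE.
  by case: (x \in _).
rewrite /deg -(@card_in_imset _ _ (fun y => [set x; y])); last first.
  move=> y z; rewrite !inE => xy xz /setP/(_ y); rewrite !inE eqxx orbT.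
  by case: eqP xy => [->|_ _ /esym/eqP //]; rewrite adj_irr.
apply/subset_leq_card/subsetP => _ /imsetP[y xy ->]; rewrite inE in xy.
have Exy : [set x; y] \in edges G.
  by rewrite inE; apply/existsP; exists x; apply/existsP; exists y; rewrite xy /=.
by apply/imsetP; exists (Sub [set x; y] Exy); rewrite ?inE ?SubK ?inE ?eqxx.
Qed.

Lemma min_deg_le (x : G) : (min_deg G <= deg x)%N.
Proof.
rewrite /min_deg; elim: (index_enum G) (mem_index_enum x) => // y s IH.
by rewrite inE big_cons geq_min => /orP[/eqP->|/IH->]; rewrite ?leqnn ?orbT.
Qed.

(** Double counting of the pairs of an edge [f] and a vertex common to [e] and [f]. The additive
    form avoids truncated subtraction. *)
Lemma deg_line_graph e : (2 * min_deg G <= deg e + 2)%N.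
Proof.
have -> : (deg e + 2 = \sum_(f : line_graph G) #|val e :&: val f|)%N.
  under eq_bigr do rewrite card_edgeI.
  rewrite big_split /= -big_distrl /= /deg addnC.
  congr (_ + _)%N.
    by rewrite (bigD1 e) //= eqxx big1 // => f /negPf; rewrite eq_sym => ->.
  rewrite -sum1_card big_mkcond /=; apply: eq_bigr => f _; rewrite inE /=.
  by case: line_adj.
have -> : (\sum_(f : line_graph G) #|val e :&: val f| = \sum_(x in val e) \sum_(f : line_graph G) (x \in val f))%N.
  rewrite exchange_big; apply: eq_bigr => f _ /=.
  by rewrite -sum1_card -big_mkcondr; apply: eq_bigl => x; rewrite inE.
rewrite -(card_edge e) -sum_nat_const; apply: leq_sum => x _.
exact: leq_trans (min_deg_le x) (deg_le_incident x).
Qed.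

Lemma line_adj_form_ge (R : realFieldType) (x : line_graph G -> R) :
  - 2 * \sum_e x e ^+ 2 <= \sum_e \sum_f x e * (adj e f)%:R * x f.
Proof.
rewrite -subr_ge0.
(* The difference is the squared norm of [B x], whose entry at [v] sums [x e] over the edges [e] at
   [v]. *)
have -> : \sum_e \sum_f x e * (adj e f)%:R * x f - - 2 * \sum_e x e ^+ 2 =
          \sum_(v : G) (\sum_(e : line_graph G) (v \in val e)%:R * x e) ^+ 2.
  transitivity (\sum_(e : line_graph G) \sum_(f : line_graph G) x e * #|val e :&: val f|%:R * x f).
    rewrite mulNr opprK mulr_sumr -big_split; apply: eq_bigr => e _ /=.
    under [RHS]eq_bigr do rewrite card_edgeI natrD mulrDr mulrDl.
    rewrite big_split /= addrC; congr (_ + _).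
    rewrite (bigD1 e) //= eqxx big1 => [|f /negPf fe]; first by rewrite mul1n; ring.
    by rewrite eq_sym fe mul0n mulr0 mul0r.
  under [RHS]eq_bigr => v _ do rewrite expr2 big_distrlr /=.
  rewrite [RHS]exchange_big; apply: eq_bigr => e _ /=.
  rewrite [RHS]exchange_big; apply: eq_bigr => f _ /=.
  rewrite -sum1_card natr_sum mulr_sumr mulr_suml big_mkcond /=.
  apply: eq_bigr => v _; rewrite inE.
  by case: (v \in val e); case: (v \in val f) => /=; ring.
by apply: sumr_ge0 => v _; exact: sqr_ge0.
Qed.

End LineGraph.

Lemma A_alpha_sym (R : rcfType) (alpha : R) (G : sgraph) :
  (A_alpha alpha G)^T = A_alpha alpha G.
Proof.
rewrite /A_alpha linearD !linearZ /= tr_diag_mx; congr (_ + _ *: _).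
by apply/matrixP => i j; rewrite !mxE adj_sym.
Qed.

Lemma A_alpha_form (R : rcfType) (alpha : R) (G : sgraph) (x : 'rV[R]_#|G|) :
  \sum_i \sum_j x 0 i * A_alpha alpha G i j * x 0 j =
  alpha * (\sum_(u : G) (deg u)%:R * x 0 (enum_rank u) ^+ 2) +
  (1 - alpha) * \sum_(u : G) \sum_(v : G)
    x 0 (enum_rank u) * (adj u v)%:R * x 0 (enum_rank v).
Proof.
have reindexG (F : 'I_#|G| -> R) : \sum_i F i = \sum_(u : G) F (enum_rank u).
  by apply: reindex; exists enum_val => ? _; rewrite ?enum_rankK ?enum_valK.
rewrite !mulr_sumr -big_split /= reindexG; apply: eq_bigr => u _.
rewrite reindexG mulr_sumr.
under eq_bigr => v _ do rewrite !mxE !enum_rankK mulrDr mulrDl.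
rewrite big_split /=; congr (_ + _); last by apply: eq_bigr => v _; ring.
(* The degree matrix is diagonal, so only the term [v = u] survives. *)
rewrite (bigD1 u) //= eqxx big1 => [|v vu]; first by rewrite mulr1n; ring.
by rewrite (inj_eq enum_rank_inj) eq_sym (negPf vu) mulr0n; ring.
Qed.

Theorem theorem12 (R : realType) (G : sgraph) (m : nat) (alpha : R)
    (hm : #|edges G| = m) (hm1 : (1 <= m)%N)
    (halpha0 : 0 <= alpha) (halpha1 : alpha < 1) :
  2 * alpha * (min_deg G)%:R - 2 <= lambda m (A_alpha alpha (line_graph G)).
Proof.
have cardL : #|line_graph G| = m by rewrite -hm card_sig; apply: eq_card.
apply: eigenvalue_ge (lambda_symmetric_eigenvalue (A_alpha_sym _ _) _); last first.
  by rewrite hm1 cardL leqnn.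
move=> x; rewrite A_alpha_form.
pose y (e : line_graph G) : R := x 0 (enum_rank e).
have -> : \sum_i x 0 i ^+ 2 = \sum_e y e ^+ 2.
  by apply: reindex; exists enum_val => ? _; rewrite ?enum_rankK ?enum_valK.
have degB : (2 * (min_deg G)%:R - 2) * (\sum_e y e ^+ 2) <= \sum_e (deg e)%:R * y e ^+ 2.
  rewrite mulr_sumr; apply: ler_sum => e _; apply: ler_wpM2r; first exact: sqr_ge0.
  by rewrite lerBlDr -natrM -natrD ler_nat deg_line_graph.
have := line_adj_form_ge y.
(* The adjacency bound is weighted by [1 - alpha] and the degree bound by [alpha]; their sum is the
   claim. *)
rewrite -(ler_pM2l (_ : 0 < 1 - alpha)) ?subr_gt0 //.
move: degB => /(ler_wpM2l halpha0) h1 h2.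
apply: le_trans (lerD h1 h2); rewrite le_eqVlt; apply/orP; left; apply/eqP; ring.
Qed.
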